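(* Let $L_f>0$, $R_0\ge1$ and $\epsilon>0$ be given. For problem dimension $n>2\lceil\sqrt{L_f}R_0/(8\sqrt\epsilon)\rceil$, there exists a smooth problem of the form described in the context with aggregate smoothness constant $L_f$ and $\|x^0-x^*\|\le R_0$ such that any DPM algorithm takes at least $\Omega(\sqrt{L_f}R_0/\sqrt\epsilon)$ communication rounds to find an $\epsilon$-optimal solution (a point $\bar x\in X$ with $f(\bar x)-f(x^* )\le\epsilon$).
   Context: Problem form: $\min_{x\in X}\{f(x):=\max_{p\in P}\sum_{i=1}^mp_if_i(x)-\rho^*(p)+u(x)\}$ with $X\subseteq\mathbb{R}^n$ closed convex, $P\subseteq\{p\in\mathbb{R}^m:\sum_ip_i=1,p\ge0\}$ closed convex, $\rho^*$, $u$ proper closed convex, and $f_i(x)=\max_{\pi_i\in\Pi_i}\langle A_ix,\pi_i\rangle-f_i^*(\pi_i)$; smooth means $A_i=I$, $f_i$ convex with Lipschitz gradient and $f_i^*$ its conjugate. $x^*$ is an optimal solution. The aggregate smoothness constant is $\max_{p\in P}L_p$, where $L_p$ is the Lipschitz constant of $\nabla\sum_ip_if_i$. $x^0=0$ is the initial point. A DPM algorithm on a star network (server plus workers, worker $i$ knowing only $f_i$, server knowing $u$, $\rho^*$, $P$) maintains a server memory $\mathcal M_s^t$ and for each worker primal and dual memories $\mathcal M_i^t$, $\mathcal M_i^{\pi,t}$, all $\{0\}$ at $t=0$. In each communication round $t$: each worker sends one vector from $\mathrm{span}(\mathcal M_i^{t-1})$ to the server and receives one vector from $\mathrm{span}(\mathcal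 M_s^{t-1})$; between rounds each worker may, any finite number of times, pick $\bar x\in\mathrm{span}$(its primal memory), $\bar\pi_i\in\mathrm{span}$(its dual memory), $\tau\ge0$, compute $\pi_i'\in\arg\max_{\pi_i\in\Pi_i}\langle A_i\bar x,\pi_i\rangle-f_i^*(\pi_i)-\frac\tau2\|\pi_i-\bar\pi_i\|^2$, add $A_i^\top\pi_i',A_i^\top\bar\pi_i$ to its primal memory and $\pi_i',A_i\bar x$ to its dual memory; and the server may, any finite number of times, add $\arg\min_{x\in X}u(x)+\frac\eta2\|x-\bar x\|^2$ for $\bar x\in\mathrm{span}$(its memory), $\eta>0$. The output after $t$ rounds lies in the span of all primal memories and the server memory. The $\Omega$ hides absolute constants. *)

(* Defs.v *)
From HB Require Import structures.
From mathcomp Require Import all_boot all_order all_algebra.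
From mathcomp Require Import classical_sets reals constructive_ereal ereal.
Unset Printing Implicit Defensive.
Import Order.TTheory GRing.Theory Num.Theory.
Local Open Scope classical_set_scope.
Local Open Scope ring_scope.

Definition vec (R : realType) (k : nat) := 'rV[R]_k.

Section DPM.
Context {R : realType}.
Local Notation vec := (vec R).

Definition dotv {k} (x y : vec k) : R := \sum_(i < k) x 0 i * y 0 i.
Definition enorm {k} (x : vec k) : R := Num.sqrt (dotv x x).

Definition closed_set {k} (S : set (vec k)) : Prop :=
  forall x, (forall e : R, 0 < e -> exists y, S y /\ enorm (x - y) < e) -> S x.

Definition convex_set {k} (S : set (vec k)) : Prop :=
  forall x y (a : R), S x -> S y -> 0 <= a <= 1 -> S (a *: x + (1 - a) *: y).

Definition convex_fun {k} (f : vec k -> R) : Prop :=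
  forall x y (a : R), 0 <= a <= 1 ->
    f (a *: x + (1 - a) *: y) <= a * f x + (1 - a) * f y.

Definition proper_fun {k} (u : vec k -> \bar R) : Prop :=
  (forall x, u x != -oo%E) /\ (exists x, u x != +oo%E).
Definition closed_fun {k} (u : vec k -> \bar R) : Prop :=
  forall x (a : R), (a%:E < u x)%E ->
    exists d : R, 0 < d /\ forall y, enorm (y - x) < d -> (a%:E < u y)%E.
Definition econvex_fun {k} (u : vec k -> \bar R) : Prop :=
  forall x y (a : R), 0 <= a <= 1 ->
    (u (a *: x + (1 - a) *: y)%R <= a%:E * u x + ((1 - a)%R)%:E * u y)%E.
Definition proper_closed_convex {k} (u : vec k -> \bar R) : Prop :=
  proper_fun u /\ closed_fun u /\ econvex_fun u.

Definition has_gradient {k} (f : vec k -> R) (g : vec k -> vec k) : Prop :=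
  forall x (e : R), 0 < e -> exists d : R, 0 < d /\
    forall h, enorm h < d -> `|f (x + h) - f x - dotv (g x) h| <= e * enorm h.

Definition lipschitz {k} (g : vec k -> vec k) (L : R) : Prop :=
  forall x y, enorm (g x - g y) <= L * enorm (x - y).

Definition span {k} (S : set (vec k)) : set (vec k) :=
  fun x => exists (q : nat) (c : 'I_q -> R) (v : 'I_q -> vec k),
    (forall j, S (v j)) /\ x = \sum_(j < q) c j *: v j.

Definition fconj {k} (f : vec k -> R) (pi : vec k) : \bar R :=
  ereal_sup (range (fun x => (dotv x pi - f x)%:E)).

Definition simplex {m} : set (vec m) :=
  fun p => (forall i, 0 <= p 0 i) /\ \sum_(i < m) p 0 i = 1.

(* Problem data: min_{x in X} max_{p in P} sum_i p_i f_i(x) - rho*(p) + u(x) *)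
Record problem (n : nat) := Problem {
  pm : nat;
  pf : 'I_pm -> vec n -> R;
  pX : set (vec n);
  pP : set (vec pm);
  prho : vec pm -> \bar R;
  pu : vec n -> \bar R }.
Arguments pm {n}. Arguments pf {n}. Arguments pX {n}. Arguments pP {n}.
Arguments prho {n}. Arguments pu {n}.

(* The problem is of the form described in the context, in the smooth case
   (A_i = I, f_i convex with Lipschitz gradient, Pi_i = R^n). *)
Definition smooth_problem {n} (pr : problem n) : Prop :=
  [/\ (0 < pm pr)%N,
      closed_set (pX pr) /\ convex_set (pX pr),
      pP pr `<=` simplex /\ closed_set (pP pr) /\ convex_set (pP pr),
      proper_closed_convex (prho pr) /\ proper_closed_convex (pu pr)
    & forall i, convex_fun (pf pr i) /\
        exists (g : vec n -> vec n) (Li : R), has_gradient (pf pr i) g /\ lipschitz g Li].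

Definition psum {n} (pr : problem n) (p : vec (pm pr)) (x : vec n) : R :=
  \sum_(i < pm pr) p 0 i * pf pr i x.

(* aggregate smoothness constant max_{p in P} L_p equals L *)
Definition aggregate_smoothness {n} (pr : problem n) (L : R) : Prop :=
  (forall p, pP pr p -> exists g, has_gradient (psum pr p) g /\ lipschitz g L) /\
  (exists p, pP pr p /\ exists g, has_gradient (psum pr p) g /\
     forall L', lipschitz g L' -> L <= L').

Definition obj {n} (pr : problem n) (x : vec n) : \bar R :=
  (ereal_sup [set y | exists2 p, pP pr p & y = ((psum pr p x)%:E - prho pr p)%E]
   + pu pr x)%E.

Definition optimal {n} (pr : problem n) (xs : vec n) : Prop :=
  pX pr xs /\ obj pr xs \is a fin_num /\ forall x, pX pr x -> (obj pr xs <= obj pr x)%E.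

Definition dual_oracle_obj {n} (f : vec n -> R) (xb pib : vec n) (tau : R)
  (pi : vec n) : \bar R :=
  ((dotv xb pi - tau / 2 * enorm (pi - pib) ^+ 2)%R%:E - fconj f pi)%E.
Definition is_dual_oracle {n} (f : vec n -> R) (xb pib : vec n) (tau : R)
  (pi' : vec n) : Prop :=
  forall pi, (dual_oracle_obj f xb pib tau pi <= dual_oracle_obj f xb pib tau pi')%E.

Definition is_prox {n} (X : set (vec n)) (u : vec n -> \bar R) (eta : R)
  (xb x' : vec n) : Prop :=
  X x' /\ forall x, X x ->
    (u x' + (eta / 2 * enorm (x' - xb) ^+ 2)%R%:E <= u x + (eta / 2 * enorm (x - xb) ^+ 2)%R%:E)%E.

(* memories: server, worker primal, worker dual *)
Record dstate (n m : nat) := DState {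
  ms : set (vec n);
  mp : 'I_m -> set (vec n);
  md : 'I_m -> set (vec n) }.
Arguments ms {n m}. Arguments mp {n m}. Arguments md {n m}.
Arguments DState {n m}.

Definition init_state n m : dstate n m :=
  DState [set 0] (fun _ => [set 0]) (fun _ => [set 0]).

Definition upd {m} {T} (F : 'I_m -> T) (i : 'I_m) (a : T) : 'I_m -> T :=
  fun j => if j == i then a else F j.

(* dpm_reach pr t S : memory state S is reachable by some DPM algorithm after
   t communication rounds (local computations are allowed at any time). *)
Inductive dpm_reach {n} (pr : problem n) : nat -> dstate n (pm pr) -> Prop :=
| dpm_init : dpm_reach pr 0 (init_state n (pm pr))
| dpm_worker t S i xb pib tau pi' :
    dpm_reach pr t S -> span (mp S i) xb -> span (md S i) pib -> 0 <= tau ->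
    is_dual_oracle (pf pr i) xb pib tau pi' ->
    dpm_reach pr t (DState (ms S)
       (upd (mp S) i (mp S i `|` [set pi'; pib]))
       (upd (md S) i (md S i `|` [set pi'; xb])))
| dpm_server t S xb eta x' :
    dpm_reach pr t S -> span (ms S) xb -> 0 < eta -> is_prox (pX pr) (pu pr) eta xb x' ->
    dpm_reach pr t (DState (ms S `|` [set x']) (mp S) (md S))
| dpm_comm t S (v w : 'I_(pm pr) -> vec n) :
    dpm_reach pr t S ->
    (forall i, span (mp S i) (v i)) -> (forall i, span (ms S) (w i)) ->
    dpm_reach pr t.+1 (DState (ms S `|` range v)
       (fun i => mp S i `|` [set w i]) (md S)).

Definition output_set {n m} (S : dstate n m) : set (vec n) :=
  span (fun y => ms S y \/ exists i, mp S i y).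

End DPM.
Arguments problem : clear implicits.
Arguments dstate : clear implicits.
Arguments init_state : clear implicits.
Arguments pm {R n}. Arguments pf {R n}. Arguments pX {R n}. Arguments pP {R n}.
Arguments prho {R n}. Arguments pu {R n}.
Arguments ms {R n m}. Arguments mp {R n m}. Arguments md {R n m}.
Arguments DState {R n m}.

(* Main.v *)
(** The hard instance is the least squares chain
    [Lf/8 * ((x_0 - b)^2 + sum_(0 < l < N) (x_l - x_(l-1))^2)], whose minimizer is
    constantly [b] on the [N] chain coordinates.  Its links are dealt by parity
    to two workers.  A local oracle call never crosses a link that the worker
    does not own, so every communication round lets the support of all memories
    grow by at most one coordinate.  As long as [x_(N-1) = 0] the residuals
    telescope to [-b], so by Cauchy-Schwarz the gap is at least
    [Lf * b^2 / (8 N)].  With [b = R0 / sqrt N] and [N] the ceiling of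
    [sqrt Lf * R0 / (8 sqrt eps)] this exceeds [eps], except when [N] is bounded
    by a constant and there is nothing to prove. *)
Require Import Defs.
From HB Require Import structures.
From mathcomp Require Import all_boot all_order all_algebra.
From mathcomp Require Import classical_sets reals constructive_ereal ereal.
From mathcomp Require Import ring lra.
Set Implicit Arguments.
Unset Strict Implicit.
Import Order.TTheory GRing.Theory Num.Theory.
Local Open Scope classical_set_scope.
Local Open Scope ring_scope.

(** * Euclidean geometry of row vectors and operator bounds *)

Section EuclideanVectors.
Context {R : realType}.
Implicit Types n r : nat.

Lemma dotv_ge0 {n} (x : vec R n) : 0 <= dotv x x.
Proof. by apply: sumr_ge0 => i _; rewrite -expr2 sqr_ge0. Qed.

Lemma dotv_eq0 {n} (x : vec R n) : dotv x x = 0 -> x = 0.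
Proof.
move=> x0; apply/rowP => i; rewrite mxE; apply/eqP.
rewrite -sqrf_eq0 expr2; apply/eqP; move: i (erefl true).
by apply: (psumr_eq0P _ x0) => i _; rewrite -expr2 sqr_ge0.
Qed.

Lemma dotvZZ {n} (a : R) (x : vec R n) : dotv (a *: x) (a *: x) = a ^+ 2 * dotv x x.
Proof. by rewrite /dotv mulr_sumr; apply: eq_bigr => i _; rewrite !mxE; ring. Qed.

Lemma enorm_ge0 {n} (x : vec R n) : 0 <= enorm x.
Proof. exact: sqrtr_ge0. Qed.

Lemma sqr_enorm {n} (x : vec R n) : enorm x ^+ 2 = dotv x x.
Proof. by rewrite sqr_sqrtr ?dotv_ge0. Qed.

Lemma enorm_eq0 {n} (x : vec R n) : enorm x = 0 -> x = 0.
Proof. by move=> x0; apply: dotv_eq0; rewrite -sqr_enorm x0 expr0n. Qed.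

Lemma enorm_le_scale {n r} (a : R) (x : vec R n) (y : vec R r) :
  0 <= a -> dotv x x <= a ^+ 2 * dotv y y -> enorm x <= a * enorm y.
Proof.
move=> a0 xy; rewrite -(ger0_norm a0) -sqrtr_sqr -sqrtrM ?sqr_ge0 //.
exact: ler_wsqrtr.
Qed.

Lemma dotv_trmx {n r} (D : 'M[R]_(n, r)) (u : vec R r) (h : vec R n) :
  dotv (u *m D^T) h = dotv u (h *m D).
Proof.
rewrite /dotv.
under eq_bigr do rewrite mxE mulr_suml.
rewrite exchange_big; apply: eq_bigr => l _ /=.
by rewrite mxE mulr_sumr; apply: eq_bigr => j _; rewrite mxE; ring.
Qed.

Definition mx_bound {n r} (D : 'M[R]_(n, r)) (C : R) :=
  forall z, dotv (z *m D) (z *m D) <= C * dotv z z.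

(** With [w = u *m D^T], the inner product of [u] and [w *m D] equals [dotv w w]. Expanding the
    square of [C *: u - w *m D] and bounding its last term by [C * dotv w w] gives the claim after
    division by [C]. *)
Lemma mx_bound_trmx {n r} (D : 'M[R]_(n, r)) (C : R) :
  0 < C -> mx_bound D C -> mx_bound D^T C.
Proof.
move=> C0 DC u; set w := u *m D^T.
have : 0 <= dotv (C *: u - w *m D) (C *: u - w *m D) by exact: dotv_ge0.
have -> : dotv (C *: u - w *m D) (C *: u - w *m D)
  = C ^+ 2 * dotv u u - 2 * C * dotv u (w *m D) + dotv (w *m D) (w *m D).
  rewrite /dotv !mulr_sumr -sumrB -big_split; apply: eq_bigr => i _ /=.
  by rewrite !mxE; ring.
rewrite -(dotv_trmx D u w) -/w => H.
rewrite -(ler_pM2l C0); have := DC w; lra.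
Qed.

End EuclideanVectors.

(** * Convexity and smoothness of weighted least squares *)

Section WeightedLeastSquares.
Context {R : realType} {n r : nat}.
Variables (D : 'M[R]_(n, r)) (b : 'I_r -> R).
Implicit Types w : 'I_r -> R.

(** The weights stay a parameter so that the same lemmas serve each worker's function and their
    average. *)
Definition wls w (x : vec R n) : R :=
  2^-1 * \sum_l w l * ((x *m D) 0 l - b l) ^+ 2.

Definition wls_grad w (x : vec R n) : vec R n :=
  (\row_l (w l * ((x *m D) 0 l - b l))) *m D^T.

Definition wls_hess w (h : vec R n) : R := \sum_l w l * (h *m D) 0 l ^+ 2.

Lemma wls_ge0 w x : (forall l, 0 <= w l) -> 0 <= wls w x.
Proof.
move=> w0; rewrite mulr_ge0 ?invr_ge0 ?ler0n //.
by apply: sumr_ge0 => l _; rewrite mulr_ge0 ?sqr_ge0.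
Qed.

Lemma wls_expand w x h :
  wls w (x + h) = wls w x + dotv (wls_grad w x) h + 2^-1 * wls_hess w h.
Proof.
rewrite /wls_grad dotv_trmx /wls /dotv /wls_hess !mulr_sumr -!big_split.
apply: eq_bigr => l _ /=; by rewrite mulmxDl !mxE; field.
Qed.

Lemma wls_gradB w x y :
  wls_grad w x - wls_grad w y = (\row_l (w l * ((x - y) *m D) 0 l)) *m D^T.
Proof.
rewrite /wls_grad -mulmxBl; congr (_ *m _); apply/rowP => l.
by rewrite mulmxBl !mxE; ring.
Qed.

Lemma wls_convex w : (forall l, 0 <= w l) -> convex_fun (wls w).
Proof.
move=> w0 x y a /andP[a0 a1]; rewrite /wls !mulr_sumr -big_split.
apply: ler_sum => l _ /=.
rewrite mulmxDl -!scalemxAl !mxE.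
set X := \sum_j _; set Y := \sum_j _.
(* Up to the factor 1/2, this is the convexity gap of the [l]-th term. *)
have : 0 <= w l * (a * (1 - a) * (X - Y) ^+ 2).
  apply: mulr_ge0 => //; apply: mulr_ge0; rewrite ?sqr_ge0 //.
  by rewrite mulr_ge0 ?subr_ge0.
lra.
Qed.

Variables (C W : R) (w : 'I_r -> R).
Hypothesis C_gt0 : 0 < C.
Hypothesis D_bound : mx_bound D C.
Hypothesis w_bound : forall l, 0 <= w l <= W.

Lemma wls_hess_ge0 h : 0 <= wls_hess w h.
Proof.
by apply: sumr_ge0 => l _; rewrite mulr_ge0 ?sqr_ge0 //; case/andP: (w_bound l).
Qed.

Lemma wls_hess_le h : 0 <= W -> wls_hess w h <= W * C * dotv h h.
Proof.
move=> W0; apply: (@le_trans _ _ (W * dotv (h *m D) (h *m D))).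
  rewrite /wls_hess /dotv mulr_sumr; apply: ler_sum => l _.
  by rewrite -expr2 ler_wpM2r ?sqr_ge0 //; case/andP: (w_bound l).
by rewrite -mulrA ler_wpM2l.
Qed.

Lemma wls_has_gradient : 0 <= W -> has_gradient (wls w) (wls_grad w).
Proof.
move=> W0 x e e0; set M := W * C.
have M0 : 0 <= M by rewrite mulr_ge0 // ltW.
have M1 : 0 < M + 1 by rewrite ltr_wpDl.
(* The remainder is at most [M / 2 * enorm h ^+ 2]; adding 1 keeps the radius meaningful when
   [M = 0]. *)
exists (e / (M + 1)); split; first exact: divr_gt0.
move=> h; rewrite ltr_pdivlMr // => hd.
rewrite wls_expand.
have -> : wls w x + dotv (wls_grad w x) h + 2^-1 * wls_hess w h - wls w x
  - dotv (wls_grad w x) h = 2^-1 * wls_hess w h by ring.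
have := wls_hess_le h W0; have := wls_hess_ge0 h.
rewrite -sqr_enorm -/M; have := enorm_ge0 h.
move: (enorm h) (wls_hess w h) hd => N H hd N0 H0 HN.
rewrite ger0_norm; last lra.
nra.
Qed.

(** The difference of gradients applies [D], the weights and [D^T] in turn, with norms at most
    [sqrt C], [W] and [sqrt C]. *)
Lemma wls_grad_lipschitz : 0 <= W -> lipschitz (wls_grad w) (W * C).
Proof.
move=> W0 x y; apply: enorm_le_scale; first by rewrite mulr_ge0 // ltW.
rewrite wls_gradB; apply: le_trans (mx_bound_trmx C_gt0 D_bound _) _.
have -> : (W * C) ^+ 2 = C * (W ^+ 2 * C) by ring.
rewrite -mulrA ler_pM2l //.
apply: (@le_trans _ _ (W ^+ 2 * dotv ((x - y) *m D) ((x - y) *m D))).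
  rewrite /dotv mulr_sumr; apply: ler_sum => l _; rewrite [X in X * _]mxE [X in _ * X <= _]mxE.
  have /andP[w0 wW] := w_bound l.
  rewrite -!expr2 exprMn ler_wpM2r ?sqr_ge0 // lerXn2r ?nnegrE //.
by rewrite -mulrA ler_wpM2l ?sqr_ge0.
Qed.

End WeightedLeastSquares.

(** * Supports of vectors and of dual oracle answers *)

Section Supports.
Context {R : realType} {n : nat}.
Implicit Types (x y : vec R n) (s : nat).

Definition supported s x := forall j : 'I_n, (s <= j)%N -> x 0 j = 0.
Definition lowpart s x : vec R n := \row_j (if (j < s)%N then x 0 j else 0).

Lemma supported0 s : supported s 0.
Proof. by move=> j _; rewrite mxE. Qed.

Lemma supported_lowpart s x : supported s (lowpart s x).
Proof. by move=> j sj; rewrite mxE ltnNge sj. Qed.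

Lemma supported_le s s' x : (s <= s')%N -> supported s x -> supported s' x.
Proof. by move=> ss' xs j s'j; apply: xs; apply: leq_trans s'j. Qed.

Lemma supported_span s (S : set (vec R n)) :
  (forall x, S x -> supported s x) -> forall x, Defs.span S x -> supported s x.
Proof.
move=> Ss x [q [c [v [Sv ->]]]] j sj.
by rewrite summxE big1 // => k _; rewrite mxE (Ss _ (Sv k)) // mulr0.
Qed.

Lemma fconj_ge (f : vec R n -> R) x pi : ((dotv x pi - f x)%:E <= fconj f pi)%E.
Proof. by apply: ereal_sup_ubound; exists x. Qed.

(* Since [f] is [M]-smooth across the splitting, testing the supremum defining
   the conjugate at [lowpart s x + M^-1 *: (pi - lowpart s pi)] shows that
   dropping the upper part [q] of [pi] lowers the conjugate by [|q|^2 / 2M];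
   this makes the maximizer supported even when [tau = 0]. *)
Lemma dual_oracle_supported (f : vec R n -> R) s (M tau : R) xb pib pi' :
  0 < M -> (forall x, 0 <= f x) ->
  (forall x y, supported s x -> lowpart s y = 0 ->
     f x <= f (x + y) <= f x + M / 2 * dotv y y) ->
  supported s xb -> supported s pib -> 0 <= tau ->
  is_dual_oracle f xb pib tau pi' -> supported s pi'.
Proof.
move=> M0 f0 fM sxb spib tau0 opt.
set p := lowpart s pi'; set q := pi' - p.
have qE j : q 0 j = if (j < s)%N then 0 else pi' 0 j.
  by rewrite !mxE; case: ifP; rewrite ?subrr ?subr0.
clearbody q.
have lowq : lowpart s (M^-1 *: q) = 0.
  apply/rowP => j; rewrite [LHS]mxE [RHS]mxE; case: ifP => // js.
  by rewrite mxE qE js mulr0.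
have conj_drop x : ((dotv x p - f x + dotv q q / (2 * M))%:E <= fconj f pi')%E.
  apply: le_trans (fconj_ge f (lowpart s x + M^-1 *: q) pi').
  rewrite lee_fin.
  have -> : dotv (lowpart s x + M^-1 *: q) pi' = dotv x p + M^-1 * dotv q q.
    rewrite /dotv mulr_sumr -big_split; apply: eq_bigr => j _ /=.
    by rewrite !mxE qE; case: ifP => _; ring.
  have /andP[_ up] := fM _ _ (@supported_lowpart s x) lowq.
  (* The lower half of the splitting hypothesis gives [f (lowpart s x) <= f x], which brings [f x]
     back into the bound. *)
  have lowx : lowpart s (x - lowpart s x) = 0.
    by apply/rowP => j; rewrite !mxE; case: (j < s)%N; rewrite ?subrr.
  have /andP[lo _] := fM _ _ (@supported_lowpart s x) lowx.
  rewrite addrC subrK in lo.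
  move: up; rewrite dotvZZ.
  have -> : M / 2 * (M^-1 ^+ 2 * dotv q q) = dotv q q / (2 * M) by (field; rewrite lt0r_neq0).
  have -> : M^-1 * dotv q q = 2 * (dotv q q / (2 * M)) by (field; rewrite lt0r_neq0).
  by move: lo; lra.
have conj0 : (fconj f 0%R <= 0)%E.
  apply: ge_ereal_sup => _ [x _ <-]; rewrite lee_fin.
  have -> : dotv x 0 = 0 by rewrite /dotv big1 // => j _; rewrite mxE mulr0.
  by rewrite sub0r oppr_le0.
(* The conjugate is above [-oo] by testing at [x = 0]; at [+oo], [pi'] would lose to the candidate
   [0], whose conjugate is at most 0. *)
have [c' cE] : exists c', fconj f pi' = c'%:E.
  have := opt 0; have := fconj_ge f 0 pi'; rewrite /dual_oracle_obj.
  case: (fconj f pi') => [c' _ _|_|]; first by exists c'.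
    move: conj0; case: (fconj f 0) => [c0||] //=.
  by [].
have low_le : (fconj f p <= (c' - dotv q q / (2 * M))%:E)%E.
  apply: ge_ereal_sup => _ [x _ <-]; rewrite lee_fin lerBrDr -lee_fin -cE.
  exact: conj_drop.
(* Replacing [pi'] by [p] keeps the linear term, as [xb] is supported, lowers the penalty by
   [tau / 2 * dotv q q] and lowers the conjugate; optimality then forces [q = 0]. *)
have opt' := opt p; rewrite /dual_oracle_obj cE in opt'.
have {opt'} := le_trans (leeB (lexx _) low_le) opt'.
rewrite -!EFinB lee_fin !sqr_enorm.
have -> : dotv xb pi' = dotv xb p.
  apply: eq_bigr => j _; rewrite !mxE; case: ltnP => // sj.
  by rewrite sxb // !mul0r.
have -> : dotv (pi' - pib) (pi' - pib) = dotv (p - pib) (p - pib) + dotv q q.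
  rewrite /dotv -big_split; apply: eq_bigr => j _ /=.
  rewrite qE !mxE; case: ltnP => sj; first ring.
  by rewrite spib //; ring.
have q0 := dotv_ge0 q.
have : 0 <= tau / 2 * dotv q q by rewrite mulr_ge0 // divr_ge0.
move=> tq H.
have /dotv_eq0 q00 : dotv q q = 0.
  have M20 : 0 < 2 * M by lra.
  have : dotv q q / (2 * M) <= 0 by move: H tq; rewrite mulrDr; lra.
  by rewrite pmulr_lle0 ?invr_gt0 // => ?; apply/eqP; rewrite eq_le q0 andbT.
by move=> j sj; have := qE j; rewrite q00 mxE ltnNge sj /= => <-.
Qed.

End Supports.

(** * The chain matrix: norm, splitting and optimality gap *)

Section Chain.
Context {R : realType} {n : nat}.
Variable N : nat.
Hypothesis N_lt : (N < n)%N.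
Implicit Types (x y : vec R n) (l : 'I_n).

(* 1-based coordinates, with value 0 at index 0 *)
Definition pcoord x (k : nat) : R := \sum_j x 0 j * (j.+1 == k)%:R.

Lemma pcoord0 x : pcoord x 0 = 0.
Proof. by rewrite /pcoord big1 // => j _; rewrite mulr0. Qed.

Lemma pcoordS x l : pcoord x l.+1 = x 0 l.
Proof.
rewrite /pcoord (bigD1 l) //= eqxx mulr1 big1 ?addr0 // => j jl.
by rewrite eqSS (inj_eq val_inj) (negbTE jl) mulr0.
Qed.

Lemma pcoord_supported s x k : supported s x -> (s < k)%N -> pcoord x k = 0.
Proof.
move=> xs sk; rewrite /pcoord big1 // => j _.
case: eqP => [jk|_]; last by rewrite mulr0.
by rewrite xs ?mul0r // -ltnS jk.
Qed.

Lemma pcoord_lowpart0 s y k : lowpart s y = 0 -> (k <= s)%N -> pcoord y k = 0.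
Proof.
move=> /rowP ys ks; rewrite /pcoord big1 // => j _.
case: eqP => [jk|_]; last by rewrite mulr0.
by have := ys j; rewrite !mxE jk ks => ->; rewrite mul0r.
Qed.

(* Column [l < N] is the link [x_l - x_(l-1)] (with [x_(-1) = 0]); the columns
   [l >= N] only serve to make the smoothness constant exactly 4. *)
Definition chain_mx : 'M[R]_n :=
  \matrix_(j, l) if (l < N)%N then (j == l)%:R - (j.+1 == l)%:R
                 else 2 * (j == l)%:R.

Lemma chainE x l : (x *m chain_mx) 0 l =
  if (l < N)%N then pcoord x l.+1 - pcoord x l else 2 * pcoord x l.+1.
Proof.
rewrite mxE /pcoord; case: ifP => lN.
  rewrite -sumrB; apply: eq_bigr => j _.
  by rewrite mxE lN eqSS (inj_eq val_inj); ring.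
rewrite mulr_sumr; apply: eq_bigr => j _.
by rewrite mxE lN eqSS (inj_eq val_inj); ring.
Qed.

(** Column [l] reads at most the coordinates [l - 1] and [l]. Together with [chain_lowpart0], this
    leaves column [s] as the only one that can see both sides of a cut at [s]. *)
Lemma chain_supported s x l :
  supported s x -> (s < l)%N -> (x *m chain_mx) 0 l = 0.
Proof.
move=> xs sl; rewrite chainE !(pcoord_supported xs) ?subr0 ?mulr0 ?if_same //.
exact: ltnW.
Qed.

Lemma chain_lowpart0 s y l :
  lowpart s y = 0 -> (l < s)%N -> (y *m chain_mx) 0 l = 0.
Proof.
move=> ys ls; rewrite chainE !(pcoord_lowpart0 ys) ?subr0 ?mulr0 ?if_same //.
exact: ltnW.
Qed.

(** For a link, [(a - c)^2 <= 2 a^2 + 2 c^2 = 4 a^2 + (2 c^2 - 2 a^2)], and the bracket telescopes.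
    The [minn] freezes [e] beyond the chain, where columns contribute exactly [4 a^2]. *)
Lemma chain_mx_bound : mx_bound chain_mx 4.
Proof.
move=> x; pose e k := 2 * pcoord x (minn k N) ^+ 2.
apply: (@le_trans _ _ (\sum_(l < n) (4 * pcoord x l.+1 ^+ 2 + (e l - e l.+1)))).
  apply: ler_sum => l _; rewrite chainE /e; case: ltnP => lN.
    rewrite (minn_idPl lN).
    have := sqr_ge0 (pcoord x l.+1 + pcoord x l); lra.
  rewrite (minn_idPr (leqW lN)) subrr addr0; lra.
rewrite big_split /= mulr_sumr.
have -> : \sum_(l < n) (e l - e l.+1) = - e n.
  have /= := telescope_sumr e (leq0n n).
  rewrite /e min0n pcoord0 expr0n mulr0 subr0 big_mkord => <-.
  by rewrite -sumrN; apply: eq_bigr => l _; rewrite opprB.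
rewrite -[leRHS]addr0 lerD //.
  apply: ler_sum => l _; rewrite pcoordS expr2 //.
by rewrite oppr_le0 mulr_ge0 ?sqr_ge0.
Qed.

Variable b : R.
Definition anchor l : R := if l == 0%N :> nat then b else 0.
Local Notation cost := (wls chain_mx anchor).

(** The one column that could mix [x] and [y] has weight 0, so no cross term survives; columns above
    [s] are not column 0 and so have no anchor. *)
Lemma chain_cost_split (w : 'I_n -> R) s x y :
  (forall l, l = s :> nat -> w l = 0) -> supported s x -> lowpart s y = 0 ->
  cost w (x + y) = cost w x + 2^-1 * wls_hess chain_mx w y.
Proof.
move=> ws xs ys; rewrite /wls /wls_hess -mulrDr -big_split; congr (_ * _).
apply: eq_bigr => l _ /=; rewrite mulmxDl mxE.
case: (ltngtP l s) => ls.
- by rewrite (chain_lowpart0 ys ls); ring.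
- rewrite (chain_supported xs ls) /anchor; case: eqP ls => [->//|_ _].
  by rewrite !subr0 add0r expr0n mulr0 add0r.
- by rewrite ws // !mul0r addr0.
Qed.

Definition chain_opt : vec R n := \row_j (if (j < N)%N then b else 0).

Lemma chain_cost_opt (w : 'I_n -> R) : (0 < N)%N -> cost w chain_opt = 0.
Proof.
move=> N0; rewrite /wls big1 ?mulr0 // => l _; rewrite chainE.
have pE (j : nat) : (j <= N)%N -> pcoord chain_opt j = if j == 0%N then 0 else b.
  case: j => [_|j jN]; first by rewrite pcoord0.
  have jn := leq_trans jN (ltnW N_lt).
  by rewrite (pcoordS _ (Ordinal jn)) mxE jN.
rewrite /anchor; case: ifP => lN.
  rewrite !pE ?(ltnW lN) //=; case: eqP => _; ring.
rewrite pcoordS mxE lN; case: eqP => [l0|_]; last ring.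
by rewrite l0 N0 in lN.
Qed.

(* The first [N] residuals telescope to [-b]. *)
Lemma chain_cost_lower (a : R) x : (0 < N)%N -> 0 <= a -> pcoord x N = 0 ->
  a * b ^+ 2 / (2 * N%:R) <= cost (fun=> a) x.
Proof.
move=> N0 a0 xN; have NR : 0 < N%:R :> R by rewrite ltr0n.
pose r' (k : nat) := pcoord x k.+1 - pcoord x k - (if k == 0%N then b else 0).
have sum_r : \sum_(0 <= k < N) r' k = - b.
  rewrite sumrB telescope_sumr // xN pcoord0 big_ltn //= big_nat_cond big1.
    by rewrite addr0 subrr sub0r.
  by move=> k /andP[/andP[k0 _] _]; case: eqP k0 => // ->.
have -> : a * b ^+ 2 / (2 * N%:R) = 2^-1 * (a * (b ^+ 2 / N%:R)).
  by field; rewrite lt0r_neq0.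
rewrite /wls -mulr_sumr ler_pM2l ?invr_gt0 //; apply: ler_wpM2l => //.
apply: (@le_trans _ _ (\sum_(0 <= k < N) r' k ^+ 2)); last first.
  rewrite big_mkord (big_ord_widen n (fun k => r' k ^+ 2)) 1?ltnW //.
  rewrite big_mkcond; apply: ler_sum => l _ /=.
  by rewrite chainE; case: ifP => _; rewrite ?sqr_ge0.
(* Cauchy-Schwarz, obtained by expanding the squared deviations from the mean [- b / N]. *)
have : 0 <= \sum_(0 <= k < N) (r' k + b / N%:R) ^+ 2.
  by apply: sumr_ge0 => k _; rewrite sqr_ge0.
have -> : \sum_(0 <= k < N) (r' k + b / N%:R) ^+ 2
    = \sum_(0 <= k < N) r' k ^+ 2 + 2 * (b / N%:R) * \sum_(0 <= k < N) r' k
      + \sum_(0 <= k < N) (b / N%:R) ^+ 2.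
  rewrite mulr_sumr -!big_split; apply: eq_bigr => k _ /=; ring.
rewrite sum_r sumr_const_nat subn0 -[_ ^+ 2 *+ N]mulr_natr.
have -> : (b / N%:R) ^+ 2 * N%:R = b ^+ 2 / N%:R by field; rewrite lt0r_neq0.
have -> : 2 * (b / N%:R) * - b = - 2 * (b ^+ 2 / N%:R) by field; rewrite lt0r_neq0.
lra.
Qed.

End Chain.

(** * The two-worker instance and support growth per round *)

Section HardProblem.
Context {R : realType} {n : nat}.
Variables (N : nat) (b L : R).
Hypotheses (N_gt0 : (0 < N)%N) (N_lt : (N < n)%N) (L_gt0 : 0 < L).

(** Averaging with [half] gives every column weight [L / 4], which the bound 4 on [chain_mx] turns
    into the smoothness constant [L]. *)
Definition link_weight (i : 'I_2) (l : 'I_n) : R :=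
  if odd l == odd i then L / 2 else 0.

Definition half : vec R 2 := const_mx 2^-1.

Local Notation cost := (wls (chain_mx N) (anchor b)).

(** The singleton [pP] trivializes the inner maximum; zero [pu] on the whole space makes the
    server's prox step return its center. *)
Definition chain_problem : problem R n :=
  @Problem R n 2 (fun i => cost (link_weight i)) setT [set half]
    (fun=> 0%E) (fun=> 0%E).

Lemma link_weight_bound i l : 0 <= link_weight i l <= L / 2.
Proof.
by rewrite /link_weight; have L0 := L_gt0; case: ifP => _; apply/andP; split; lra.
Qed.

Lemma psum_chain x : psum chain_problem half x = cost (fun=> L / 4) x.
Proof.
rewrite /psum /= /wls big_ord_recl big_ord1 !mxE -mulrDr.
rewrite -mulrDr; congr (_ * _).
rewrite -big_split mulr_sumr; apply: eq_bigr => l _ /=.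
by rewrite /link_weight /=; case: (odd l); rewrite /=; field.
Qed.

Lemma obj_chain x : obj chain_problem x = (cost (fun=> L / 4) x)%:E.
Proof.
rewrite /obj /= adde0.
suff -> : [set y | exists2 p, [set half] p & y = ((psum chain_problem p x)%:E - 0)%E]
    = [set (cost (fun=> L / 4) x)%:E] by rewrite ereal_sup1.
apply/seteqP; split => [_ [p -> ->]|_ ->] /=; first by rewrite sube0 psum_chain.
by exists half => //; rewrite sube0 psum_chain.
Qed.

Lemma zero_proper_closed_convex k : proper_closed_convex (fun _ : vec R k => 0%E).
Proof.
split; [by split => //; exists 0|split].
  by move=> x a a0; exists 1; split.
by move=> x y a _; rewrite !mule0 adde0.
Qed.

Lemma chain_smooth_problem : smooth_problem chain_problem.
Proof.
split => //=.
- split; last first.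
    split.
      move=> x H; suff : enorm (x - half) = 0 by move/enorm_eq0/eqP; rewrite subr_eq0 => /eqP.
      apply/eqP; rewrite eq_le enorm_ge0 andbT; apply/ler_addgt0Pr => e e0.
      by rewrite add0r; have [_ [-> /ltW]] := H e e0.
    by move=> _ _ a -> -> _; rewrite /= -scalerDl addrC subrK scale1r.
  move=> _ ->; split => [i|]; first by rewrite mxE invr_ge0.
  by rewrite big_ord_recl big_ord1 !mxE; field.
- by split; exact: zero_proper_closed_convex.
- have C4 : 0 < 4 :> R by [].
  move=> i; split.
    by apply: wls_convex => l; case/andP: (link_weight_bound i l).
  have L20 : 0 <= L / 2 by rewrite divr_ge0 // ltW.
  exists (wls_grad (chain_mx N) (anchor b) (link_weight i)), (L / 2 * 4); split.
    exact: (wls_has_gradient _ C4 (chain_mx_bound N) (link_weight_bound i) L20).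
  exact: (wls_grad_lipschitz _ C4 (chain_mx_bound N) (link_weight_bound i) L20).
Qed.

Lemma chain_aggregate_smoothness : aggregate_smoothness chain_problem L.
Proof.
have C4 : 0 < 4 :> R by [].
have L40 : 0 <= L / 4 by rewrite divr_ge0 // ltW.
have wb (l : 'I_n) : 0 <= L / 4 <= L / 4 by rewrite L40 lexx.
pose g : vec R n -> vec R n := wls_grad (chain_mx N) (anchor b) (fun=> L / 4).
have gP : has_gradient (psum chain_problem half) g.
  move=> x e e0.
  have [d [d0 dP]] := wls_has_gradient (anchor b) C4 (chain_mx_bound N) wb L40 x e0.
  by exists d; split => // h hd; rewrite !psum_chain; exact: dP.
split.
  move=> _ ->; exists g; split=> //.
  have -> : L = L / 4 * 4 by field.
  exact: (wls_grad_lipschitz _ C4 (chain_mx_bound N) wb L40).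
(* Coordinate [N] lies just past the chain: [chain_mx] and its transpose both double its unit
   vector, so the gradient moves by exactly [L] along it. *)
exists half; split => //; exists g; split => // L' /(_ (delta_mx 0 (Ordinal N_lt)) 0).
set d : vec R n := delta_mx _ _.
have dD : d *m chain_mx N = 2 *: d.
  apply/rowP => l; rewrite -rowE !mxE eqxx /= -!val_eqE /= [in LHS]eq_sym.
  case: (ltngtP l N) => lN //=.
  by rewrite (gtn_eqF (leqW lN)) subrr mulr0.
have dDT : d *m (chain_mx N)^T = 2 *: d.
  by apply/rowP => j; rewrite -rowE !mxE eqxx /= ltnn -!val_eqE /=.
have -> : g d - g 0 = L *: d.
  rewrite wls_gradB subr0 dD.
  have -> : \row_l (L / 4 * (2 *: d) 0 l) = (L / 2) *: d.
    by apply/rowP => l; rewrite !mxE; field.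
  by rewrite -scalemxAl dDT scalerA; congr (_ *: _); field.
have d1 : dotv d d = 1.
  rewrite /dotv (bigD1 (Ordinal N_lt)) //= big1 => [|j /negbTE jN].
    by rewrite mxE !eqxx mulr1 addr0.
  by rewrite mxE jN andbF mulr0.
by rewrite subr0 /enorm dotvZZ d1 sqrtr1 !mulr1 sqrtr_sqr ger0_norm // ltW.
Qed.

(** The least index from [t] on whose column worker [i] does not own: a worker owning link [t] can
    cross it, but is stopped at link [t + 1]. *)
Definition worker_level (t : nat) (i : 'I_2) : nat := t + (odd t == odd i).

Lemma odd_worker_level t i : odd (worker_level t i) != odd i.
Proof.
rewrite /worker_level oddD oddb; by case: (odd t); case: (odd i).
Qed.

Lemma worker_level_le t i : (worker_level t i <= t.+1)%N.
Proof. by rewrite /worker_level -(addn1 t) leq_add2l leq_b1. Qed.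

Lemma worker_level_ge t i : (t <= worker_level t i)%N.
Proof. exact: leq_addr. Qed.

Lemma chain_worker_supported t (i : 'I_2) tau xb pib pi' :
  supported (worker_level t i) xb -> supported (worker_level t i) pib ->
  0 <= tau -> is_dual_oracle (pf chain_problem i) xb pib tau pi' ->
  supported (worker_level t i) pi'.
Proof.
have L20 : 0 <= L / 2 by rewrite divr_ge0 // ltW.
(* The constant [2 * L] is the weight [L / 2] times the matrix bound 4. *)
apply: (@dual_oracle_supported _ _ _ _ (2 * L)); first by rewrite mulr_gt0.
  by move=> x; apply: wls_ge0 => l; case/andP: (link_weight_bound i l).
move=> x y xs ys; rewrite /= (chain_cost_split _ _ _ xs ys); last first.
  move=> l ls; rewrite /link_weight ls; case: eqP => // e.
  by have := odd_worker_level t i; rewrite e eqxx.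
have := wls_hess_ge0 (chain_mx N) (link_weight_bound i) y.
have := wls_hess_le (chain_mx_bound N) (link_weight_bound i) y L20.
by move=> ? ?; apply/andP; split; lra.
Qed.

Lemma prox_zero (eta : R) (xb x' : vec R n) :
  0 < eta -> is_prox setT (fun=> 0%E) eta xb x' -> x' = xb.
Proof.
move=> eta0 [_ /(_ xb Logic.I)]; rewrite !add0e lee_fin subrr => H.
apply/eqP; rewrite -subr_eq0; apply/eqP/dotv_eq0/eqP.
rewrite eq_le dotv_ge0 andbT -(ler_pM2l (divr_gt0 eta0 (ltr0n _ 2))) -sqr_enorm mulr0.
by rewrite (le_trans H) // sqr_enorm /dotv big1 ?mulr0 // => j _; rewrite mxE mulr0.
Qed.

(** Local steps preserve the levels. A round lifts the server to [t.+1], which lies between the old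
    and the new level of each worker. *)
Lemma dpm_supported t S : dpm_reach chain_problem t S ->
  (forall x, ms S x -> supported t x) /\
  (forall i x, mp S i x \/ md S i x -> supported (worker_level t i) x).
Proof.
elim=> {t S} [|t S i xb pib tau pi' _ [IHs IHw] sxb spib tau0 opt
              |t S xb eta x' _ [IHs IHw] sxb eta0 prox
              |t S v w _ [IHs IHw] sv sw].
- by split=> [x ->|i x [] ->]; exact: supported0.
- have xbP : supported (worker_level t i) xb.
    by apply: supported_span sxb => x ?; apply: IHw; left.
  have pibP : supported (worker_level t i) pib.
    by apply: supported_span spib => x ?; apply: IHw; right.
  have piP := chain_worker_supported xbP pibP tau0 opt.
  split=> [x /IHs //|j x] /=; rewrite /upd.
  case: eqP => [->|_]; last exact: IHw.
  by case=> -[?|[]->] //; apply: IHw; [left|right].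
- split=> [x [/IHs //|->]|i x H]; last exact: IHw.
  by rewrite (prox_zero eta0 prox); apply: supported_span sxb.
- split=> [x [/IHs|[i _ <-]]|i x H] /=.
  + exact/supported_le/leqnSn.
  + apply: supported_le (worker_level_le t i) _.
    by apply: supported_span (sv i) => y ?; apply: IHw; left.
  + have old : mp S i x \/ md S i x -> supported (worker_level t.+1 i) x.
      move=> /IHw; apply: supported_le.
      exact: leq_trans (worker_level_le t i) (worker_level_ge t.+1 i).
    case: H => [[?|->]|?]; [by apply: old; left| |by apply: old; right].
    apply: (supported_le _ (supported_span IHs (sw i))).
    exact: leq_trans (worker_level_ge t.+1 i).
Qed.

Lemma dpm_output_supported t S x :
  dpm_reach chain_problem t S -> output_set S x -> supported t.+1 x.
Proof.
move=> /dpm_supported[Hs Hw]; apply: supported_span => y [/Hs|[i yi]].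
  exact/supported_le/leqnSn.
by apply: supported_le (worker_level_le t i) _; apply: Hw; left.
Qed.

Lemma chain_optimal : optimal chain_problem (chain_opt N b).
Proof.
split=> //; rewrite obj_chain; split=> // x _; rewrite obj_chain lee_fin.
by rewrite chain_cost_opt // wls_ge0 // => _; rewrite divr_ge0 // ltW.
Qed.

(** If [t.+1 < N], the output misses the last chain coordinate, and [chain_cost_lower] puts its gap
    above [eps]. *)
Lemma dpm_rounds t S x (eps : R) :
  dpm_reach chain_problem t S -> output_set S x ->
  (obj chain_problem x <= obj chain_problem (chain_opt N b) + eps%:E)%E ->
  eps < L * b ^+ 2 / (8 * N%:R) -> (N <= t.+1)%N.
Proof.
move=> reach out; rewrite !obj_chain chain_cost_opt // add0e lee_fin => xe epsL.
rewrite leqNgt; apply/negP => tN.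
have xN : pcoord x N = 0 by apply: pcoord_supported tN; apply: dpm_output_supported out.
have L40 : 0 <= L / 4 by rewrite divr_ge0 // ltW.
have := chain_cost_lower N_lt b N_gt0 L40 xN.
have -> : L / 4 * b ^+ 2 / (2 * N%:R) = L * b ^+ 2 / (8 * N%:R).
  by field; rewrite lt0r_neq0 // ltr0n.
lra.
Qed.

End HardProblem.

(** * Choice of parameters and the final rate *)

Unset Implicit Arguments.

Theorem theorem5p2 (R : realType) :
  exists c : R, 0 < c /\
  forall (Lf R0 eps : R) (n : nat),
    0 < Lf -> 1 <= R0 -> 0 < eps ->
    (2 * Num.ceil (Num.sqrt Lf * R0 / (8 * Num.sqrt eps)) < n%:Z)%R ->
    exists pr : problem R n,
      smooth_problem pr /\ aggregate_smoothness pr Lf /\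
      exists xs : vec R n,
        optimal pr xs /\ enorm (0 - xs) <= R0 /\
        forall (t : nat) (S : dstate R n (pm pr)),
          dpm_reach pr t S ->
          forall xb, output_set S xb -> pX pr xb ->
          (obj pr xb <= obj pr xs + eps%:E)%E ->
          c * (Num.sqrt Lf * R0 / Num.sqrt eps) <= t.+1%:R.
Proof.
(* The factor comes from [K / 8 <= N <= t.+1], with [N] the ceiling of [K / 8]. *)
exists (1 / 8); split; first lra.
move=> Lf R0 eps n Lf0 R01 eps0.
set K := Num.sqrt Lf * R0 / Num.sqrt eps.
have se0 : 0 < Num.sqrt eps by rewrite sqrtr_gt0.
have K0 : 0 < K by rewrite divr_gt0 // mulr_gt0 ?sqrtr_gt0 //; lra.
have -> : Num.sqrt Lf * R0 / (8 * Num.sqrt eps) = K / 8.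
  by rewrite /K; field; rewrite lt0r_neq0.
have c0 : 0 < Num.ceil (K / 8) by rewrite ceil_gt0 divr_gt0.
have [N NE] : exists N : nat, Num.ceil (K / 8) = N%:Z.
  by case: (Num.ceil (K / 8)) c0 => // N _; exists N.
have := ceil_itv (K / 8); rewrite NE => /andP[NK KN].
have {}KN : K / 8 <= N%:R by rewrite pmulrn.
have {}NK : N%:R < K / 8 + 1 by move: NK; rewrite intrB -pmulrn; lra.
rewrite NE in c0 => Nn.
have {}c0 : (0 < N)%N by [].
have {}Nn : (N < n)%N.
  apply: leq_ltn_trans (_ : (2 * N < n)%N); first by rewrite leq_pmull.
  by rewrite -ltz_nat PoszM.
have NR : 0 < N%:R :> R by rewrite ltr0n.
(* Chosen so that the minimizer, with [N] entries equal to [b], has norm exactly [R0]. *)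
pose b := R0 / Num.sqrt N%:R.
have bE : b ^+ 2 = R0 ^+ 2 / N%:R by rewrite /b expr_div_n sqr_sqrtr // ltW.
exists (chain_problem N b Lf).
split; first exact: chain_smooth_problem.
split; first exact: chain_aggregate_smoothness.
exists (chain_opt N b); split; first exact: chain_optimal.
split.
  have -> : R0 = Num.sqrt (R0 ^+ 2) by rewrite sqrtr_sqr ger0_norm //; lra.
  apply: ler_wsqrtr; rewrite /dotv.
  rewrite (eq_bigr (fun j : 'I_n => if (j < N)%N then b ^+ 2 else 0)); last first.
    by move=> j _; rewrite !mxE; case: ifP => _; ring.
  rewrite -big_mkcond -(big_ord_widen n (fun=> b ^+ 2)) 1?ltnW //.
  by rewrite sumr_const card_ord -mulr_natr bE divfK // lt0r_neq0.
move=> t S reach x out _ xe.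
(* For [K <= 8] the claimed bound is at most 1, hence at most [t.+1]. *)
have [K8|K8] := leP K 8.
  have : 1 <= t.+1%:R :> R by rewrite ler1n.
  lra.
suff : (N <= t.+1)%N.
  rewrite -(ler_nat R); lra.
apply: (dpm_rounds _ _ _ reach out xe) => //.
rewrite bE.
have KE : K ^+ 2 * eps = Lf * R0 ^+ 2.
  rewrite /K expr_div_n exprMn !sqr_sqrtr ?divfK // ?lt0r_neq0 // ltW //.
have -> : Lf * (R0 ^+ 2 / N%:R) / (8 * N%:R) = K ^+ 2 * eps / (8 * N%:R ^+ 2).
  by rewrite KE; field; rewrite lt0r_neq0.
rewrite ltr_pdivlMr ?mulr_gt0 ?exprn_gt0 // mulrC ltr_pM2r //.
(* As [K > 8], [N < K / 8 + 1 < K / 4], so [8 * N ^+ 2] is below [K ^+ 2 / 2]. *)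
nra.
Qed.
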